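(* The $\mathbb{F}_p(z)$-subspace $\mathcal{M}_{\mathbb{F}_p(z)}\subset\mathbb{F}_p(z)^n$ spanned by the vectors $P^{lp-1}(z)$, $l=1,\dots,ak$, is invariant with respect to the KZ connection. Namely, for any element $I=\sum_{l=1}^{ak}c_l(z)P^{lp-1}(z)$, with $c_l(z)\in\mathbb{F}_p(z)$, of $\mathcal{M}_{\mathbb{F}_p(z)}$ and any $i=1,\dots,n$, $$\nabla_i I=\sum_{l=1}^{ak}\frac{\partial c_l}{\partial z_i}(z)\,P^{lp-1}(z)\in\mathcal{M}_{\mathbb{F}_p(z)} .$$
   Context: Let $p,q$ be prime numbers, $k$ a positive integer, $n=kq+1$, and $p>n$. Let $z=(z_1,\dots,z_n)$, and let $\mathbb{F}_p(z)=\mathbb{F}_p(z_1,\dots,z_n)$ be the field of rational functions. Let $a$ be the unique integer with $1\le a<q$ and $q\mid(ap-1)$; put $M=(ap-1)/q\in\mathbb{Z}_{>0}$. Let $\Phi(x,z)=\prod_{i=1}^n(x-z_i)^M$ over $\mathbb{F}_p$, and define vectors $P^i(z)\in\mathbb{F}_p[z_1,\dots,z_n]^n$ by the expansion $$\Big(\frac{\Phi(x,z)}{x-z_1},\dots,\frac{\Phi(x,z)}{x-z_n}\Big)=\sum_i P^i(z)\,x^i .$$ The vectors $P^{lp-1}(z)$, $l=1,\dots,ak$, are called arithmetic solutions. For $i\ne j$, let $\Omega_{ij}$ be the $n\times n$ matrix whose $(i,i)$ and $(j,j)$ entries are $-1$, whose $(i,j)$ and $(j,i)$ entries are $1$, and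 whose other entries are $0$. The KZ connection is given by the operators $$\nabla_i=\frac{\partial}{\partial z_i}-\frac1q\sum_{j\ne i}\frac{\Omega_{ij}}{z_i-z_j}:\ \mathbb{F}_p(z)^n\to\mathbb{F}_p(z)^n,\qquad i=1,\dots,n,$$ where $\mathbb{F}_p(z)^n$ consists of column vectors. *)

(* Defs.v *)
From HB Require Import structures.
From mathcomp Require Import all_boot all_order all_algebra.
From mathcomp Require Import ring.
From mathcomp Require Import mpoly.

Set Implicit Arguments.
Unset Strict Implicit.
Unset Printing Implicit Defensive.

Import GRing.Theory.
Local Open Scope ring_scope.

Notation "x %:F" := (@FracField.tofrac _ x) : ring_scope.

(* Partial derivative of a rational function: the quotient rule applied to    *)
(* the canonical representative of the fraction.  By ratderiv_frac below, any *)
(* representative gives the same value.                                       *)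
Definition ratderiv (R : idomainType) (n : nat) (i : 'I_n)
    (f : {fraction {mpoly R[n]}}) : {fraction {mpoly R[n]}} :=
  let a := \n_(repr f) in
  let b := \d_(repr f) in
  (a^`M(i) * b - a * b^`M(i))%:F / (b ^+ 2)%:F.

Lemma quotient_rule_aux (R : comPzRingType) (a b c d a' b' c' d' : R) :
  a * d = c * b -> a' * d + a * d' = c' * b + c * b' ->
  (c' * d - c * d') * b ^+ 2 = (a' * b - a * b') * d ^+ 2.
Proof.
move=> h h'.
have -> : (c' * d - c * d') * b ^+ 2 =
   (c' * b + c * b') * (d * b) - (c * b) * (b' * d) - (c * b) * (d' * b) by ring.
by rewrite -h' -h; ring.
Qed.

Lemma frac_repr (R : idomainType) (f : {fraction R}) :
  f = (\n_(repr f))%:F / (\d_(repr f))%:F.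
Proof.
have d0 : (\d_(repr f))%:F != 0 by rewrite tofrac_eq0 denom_ratioP.
apply: (mulIf d0); rewrite divfK //.
rewrite -{1}[f]reprK.
move: (repr f) => x; rewrite /FracField.tofrac; unlock => /=.
rewrite -[LHS]FracField.pi_mul.
apply/eqP; rewrite FracField.equivf_def.
by rewrite /FracField.mulf !numden_Ratio ?mulf_neq0 ?oner_eq0 ?denom_ratioP //
  !mulr1 mulrC.
Qed.

Lemma ratderiv_frac (R : idomainType) (n : nat) (i : 'I_n)
    (a b : {mpoly R[n]}) : b != 0 ->
  ratderiv i (a%:F / b%:F) =
    (a^`M(i) * b - a * b^`M(i))%:F / (b ^+ 2)%:F.
Proof.
move=> b0; rewrite /ratderiv.
have := frac_repr (a%:F / b%:F).
have := denom_ratioP (repr (a%:F / b%:F)).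
move: (\n_(repr _)) (\d_(repr _)) => c d d0.
move/eqP; rewrite eqr_div ?tofrac_eq0 // -!tofracM tofrac_eq => /eqP adcb.
apply/eqP; rewrite eqr_div ?tofrac_eq0 ?expf_neq0 //.
rewrite -!tofracM tofrac_eq; apply/eqP.
apply: quotient_rule_aux => //.
by rewrite -!mderivM adcb.
Qed.

(* F_p(z) with p prime; z_i is 'X_i, the index i running from 0 to n - 1. *)
Notation ratfield p n := {fraction {mpoly 'F_p[n]}}.

Definition zvar (p n : nat) (i : 'I_n) : ratfield p n := ('X_i)%:F.

Definition Phi (p n M : nat) : {poly {mpoly 'F_p[n]}} :=
  \prod_(i < n) ('X - ('X_i)%:P) ^+ M.

(* Euclidean quotient; the division is exact for M > 0 by Phi_quotK. *)
Definition Phi_quot (p n M : nat) (j : 'I_n) : {poly {mpoly 'F_p[n]}} :=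
  Phi p n M %/ ('X - ('X_j)%:P).

Lemma prod_quotK (R : idomainType) (n M : nat) (x : 'I_n -> R) (j : 'I_n) :
    (0 < M)%N ->
  let F := \prod_(i < n) ('X - (x i)%:P) ^+ M in
  F %/ ('X - (x j)%:P) * ('X - (x j)%:P) = F.
Proof.
case: M => // M _ F; apply: Pdiv.IdomainUnit.divpK.
  by rewrite lead_coefXsubC unitr1.
rewrite /F (bigD1 j) //=; by apply/dvdp_mulr; rewrite exprS; exact: dvdp_mulIl.
Qed.

Lemma Phi_quotK (p n M : nat) (j : 'I_n) : (0 < M)%N ->
  Phi_quot p M j * ('X - ('X_j)%:P) = Phi p n M.
Proof. exact: (@prod_quotK _ n M (fun i => 'X_i) j). Qed.

(* The vector P^i(z), viewed in F_p(z)^n. *)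
Definition Pvec (p n M i : nat) : 'cV[ratfield p n]_n :=
  \col_(j < n) ((Phi_quot p M j)`_i)%:F.

(* For l : 'I_(a * k), the solution has number l.+1, which runs over 1, ..., a k. *)
Definition arith_sol (p q k n a : nat) (l : 'I_(a * k)) : 'cV[ratfield p n]_n :=
  Pvec p n ((a * p - 1) %/ q) (l.+1 * p - 1).

Definition arith_space (p q k n a : nat) : {vspace 'cV[ratfield p n]_n} :=
  <<[seq @arith_sol p q k n a l | l : 'I_(a * k)]>>%VS.

Definition Omega (R : pzRingType) (n : nat) (i j : 'I_n) : 'M[R]_n :=
  \matrix_(s, t)
    if ((s, t) == (i, i)) || ((s, t) == (j, j)) then -1
    else if ((s, t) == (i, j)) || ((s, t) == (j, i)) then 1
    else 0.

Definition nabla (p q n : nat) (i : 'I_n) (v : 'cV[ratfield p n]_n) :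
    'cV[ratfield p n]_n :=
  map_mx (ratderiv i) v
  - (q%:R)^-1 *:
      ((\sum_(j < n | j != i) (zvar p i - zvar p j)^-1 *: Omega _ i j) *m v).

(* Main.v *)
(* Write F_j = Phi / (x - z_j) and let D = d/dz_i act on coefficients.  Both D
   and d/dx are derivations, so they send Phi to the corresponding logarithmic
   derivative of Phi; cancelling linear factors gives
     D F_j = - M (F_i - F_j) / (z_i - z_j)                        (j <> i),
     D F_i = - dF_i/dx + M \sum_(j <> i) (F_i - F_j) / (z_i - z_j).
   Since M q = a p - 1, the constant - M is 1 / q in characteristic p, so
   nabla_i annihilates every vector (F_j)_j up to the term - dF_i/dx in
   position i, and the coefficient of x^(l p - 1) in an x-derivative
   is a multiple of l p, hence 0.  The Leibniz rule then gives the theorem. *)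
Require Import Defs.
From HB Require Import structures.
From mathcomp Require Import all_boot all_order all_algebra.
From mathcomp Require Import ring.
From mathcomp Require Import mpoly.

Set Implicit Arguments.
Unset Strict Implicit.
Unset Printing Implicit Defensive.

Import GRing.Theory.
Local Open Scope ring_scope.

(** * Derivations of rings and their action on coefficients *)

Definition leibniz {R : pzRingType} (d : R -> R) :=
  forall x y, d (x * y) = d x * y + x * d y.

Lemma leibniz1 (R : pzRingType) (d : R -> R) : leibniz d -> d 1 = 0.
Proof.
move=> dM; have := dM 1 1; rewrite !mulr1 mul1r => h.
by apply: (addrI (d 1)); rewrite -h addr0.
Qed.

Lemma leibnizXn (R : comPzRingType) (d : R -> R) (x : R) (m : nat) :
  leibniz d -> d (x ^+ m.+1) = (d x * x ^+ m) *+ m.+1.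
Proof.
move=> dM; elim: m => [|m IH]; first by rewrite expr1 expr0 mulr1.
rewrite exprS dM IH [in RHS]mulrS [x ^+ m.+1]exprS -mulrnAr; congr (_ + _).
by rewrite !mulrnAr; congr (_ *+ _); ring.
Qed.

(** A list makes the induction direct; [uniq r] ensures that the condition [j != i] drops exactly
    one factor. *)
Lemma leibniz_prod (R : comPzRingType) (d : R -> R) (I : eqType) (r : seq I)
    (g : I -> R) :
  leibniz d -> uniq r ->
  d (\prod_(i <- r) g i) =
    \sum_(i <- r) d (g i) * \prod_(j <- r | j != i) g j.
Proof.
move=> dM; elim: r => [|x r IH] /=; first by rewrite !big_nil leibniz1.
case/andP=> xr ur; rewrite !big_cons dM IH // eqxx; congr (_ * _ + _).
  rewrite [LHS]big_seq [RHS]big_seq_cond; apply: eq_bigl => j.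
  by case: eqP => [->|]; rewrite ?(negPf xr) ?andbT.
rewrite big_distrr /= !big_seq; apply: eq_bigr => j jr.
rewrite big_cons; case: eqP => [xj|_]; first by rewrite xj jr in xr.
by rewrite mulrCA.
Qed.

(** The logarithmic derivative without denominators: [Q j] stands for the product divided by [f j].
    It serves both for d/dx and for a derivation acting on coefficients. *)
Lemma leibniz_prodXn (R : idomainType) (d : R -> R) (n M : nat)
    (f Q : 'I_n -> R) :
    leibniz d -> (0 < M)%N -> (forall j, f j != 0) ->
    (forall j, Q j * f j = \prod_(i < n) f i ^+ M) ->
  d (\prod_(i < n) f i ^+ M) = (\sum_(j < n) d (f j) * Q j) *+ M.
Proof.
case: M => // M dM _ f0 Qf; rewrite leibniz_prod ?index_enum_uniq //.
rewrite -sumrMnl; apply: eq_bigr => j _.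
rewrite leibnizXn // mulrnAl -mulrA; congr (_ * _ *+ _).
by apply: (mulIf (f0 j)); rewrite Qf [RHS](bigD1 j) //= exprSr; ring.
Qed.

Lemma leibniz_map_poly (R : nzRingType) (d : {additive R -> R}) :
  leibniz d -> leibniz (map_poly d).
Proof.
move=> dM p q; apply/polyP => m.
rewrite coefD !coef_map !coefM raddf_sum -big_split /=.
by apply: eq_bigr => i _; rewrite !coef_map dM.
Qed.

Lemma leibniz_map_XsubC (R : nzRingType) (d : {additive R -> R}) (c : R) :
  leibniz d -> map_poly d ('X - c%:P) = - (d c)%:P.
Proof.
move=> dM; rewrite raddfB /= map_polyC /=; apply/polyP => m.
rewrite coefB coefN coef_map coefX -[RHS]add0r; congr (_ - _).
(* The coefficients of ['X] are 0 and 1, and [d] kills both. *)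
by case: (m == 1)%N; rewrite ?raddf0 //= leibniz1.
Qed.

(** * Derivatives of the quotients of a product of powers of linear factors *)

Lemma quot_sub (R : comNzRingType) (x y : R) (F G : {poly R}) :
  F * ('X - x%:P) = G * ('X - y%:P) ->
  (F - G) * ('X - y%:P) = (x - y) *: F.
Proof.
move=> h; rewrite mulrBl -h -mul_polyC rmorphB /=; ring.
Qed.

(** Carries the factorisation from polynomial coefficients to the fraction field, where the
    differences z_i - z_j can be inverted. *)
Lemma map_quotK (R S : comNzRingType) (f : {rmorphism R -> S}) (n M : nat)
    (x : 'I_n -> R) (c : R) (G : {poly R}) :
  G * ('X - c%:P) = \prod_(l < n) ('X - (x l)%:P) ^+ M ->
  map_poly f G * ('X - (f c)%:P) = \prod_(l < n) ('X - (f (x l))%:P) ^+ M.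
Proof.
move=> Gc; rewrite -map_polyXsubC -rmorphM Gc rmorph_prod /=.
by apply: eq_bigr => l _; rewrite rmorphXn /= map_polyXsubC.
Qed.

Section QuotientDerivatives.
Variables (K : fieldType) (n M : nat) (d : {additive K -> K}).
Variables (z : 'I_n -> K) (i : 'I_n) (F : 'I_n -> {poly K}).
Hypotheses (dM : leibniz d) (M_gt0 : (0 < M)%N) (z_inj : injective z).
Hypothesis dz : forall j, d (z j) = (j == i)%:R.
Let phi := \prod_(j < n) ('X - (z j)%:P) ^+ M.
Hypothesis FK : forall j, F j * ('X - (z j)%:P) = phi.

Let d_phi : map_poly d phi = - (F i *+ M).
Proof.
rewrite (@leibniz_prodXn _ _ n M _ F (leibniz_map_poly dM)) //; last first.
  by move=> j; rewrite polyXsubC_eq0.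
rewrite (bigD1 i) //= big1 ?addr0 => [|j ji].
  by rewrite leibniz_map_XsubC // dz eqxx mulNr mul1r mulNrn.
by rewrite leibniz_map_XsubC // dz (negPf ji) oppr0 mul0r.
Qed.

Let deriv_phi : phi^`() = (\sum_(j < n) F j) *+ M.
Proof.
rewrite (@leibniz_prodXn _ (@deriv K) n M _ F (@derivM K)) //; last first.
  by move=> j; rewrite polyXsubC_eq0.
by congr (_ *+ _); apply: eq_bigr => j _; rewrite derivXsubC mul1r.
Qed.

(** For j <> i the derivation kills x - z_j, so applying it to F_j (x - z_j) = phi gives (d F_j) (x
    - z_j) = - M F_i. By [quot_sub], (F_i - F_j) (x - z_j) = (z_i - z_j) F_i; cancel x - z_j. *)
Lemma deriv_quot_neq (j : 'I_n) : j != i ->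
  map_poly d (F j) = - ((z i - z j)^-1 *: (F i - F j)) *+ M.
Proof.
move=> ji; have zij : z i - z j != 0.
  by rewrite subr_eq0 (inj_eq z_inj) eq_sym.
have Xj : 'X - (z j)%:P != 0 by rewrite polyXsubC_eq0.
apply: (mulIf Xj); rewrite mulrnAl mulNr -scalerAl (@quot_sub _ (z i)) ?FK //.
rewrite scalerA mulVf // scale1r mulNrn -d_phi -(FK j) leibniz_map_poly //.
by rewrite leibniz_map_XsubC // dz (negPf ji) oppr0 mulr0 addr0.
Qed.

(** Differentiating F_i (x - z_i) = phi by [d] leaves an extra - F_i, and by d/dx an extra + F_i.
    Adding the two equations removes both and leaves M times the sum of the F_j with j <> i. *)
Lemma deriv_quot_eq :
  map_poly d (F i) =
    - (F i)^`() + (\sum_(j < n | j != i) (z i - z j)^-1 *: (F i - F j)) *+ M.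
Proof.
have Xi : 'X - (z i)%:P != 0 by rewrite polyXsubC_eq0.
apply: (mulIf Xi); rewrite mulrDl mulNr mulrnAl mulr_suml.
(* After multiplication by x - z_i, each divided difference becomes F_j by [quot_sub]. *)
rewrite [X in X *+ M](_ : _ = \sum_(j < n | j != i) F j); last first.
  apply: eq_bigr => j ji.
  rewrite -scalerAl -[F i - F j]opprB mulNr (@quot_sub _ (z j)) ?FK // -scaleNr opprB scalerA.
  by rewrite mulVf ?scale1r // subr_eq0 (inj_eq z_inj) eq_sym.
have := d_phi; have := deriv_phi.
rewrite -(FK i) derivM derivXsubC mulr1 (leibniz_map_poly dM).
rewrite leibniz_map_XsubC // dz eqxx (bigD1 i) //= mulrnDl => h1 h2.
have -> : map_poly d (F i) * ('X - (z i)%:P) = F i - F i *+ M.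
  by rewrite -h2; ring.
by rewrite -[in RHS](addrK (F i) (_ * _)) h1; ring.
Qed.

End QuotientDerivatives.

(** * Partial derivatives as derivations of the field of rational functions *)

Lemma quotient_ruleB (K : fieldType) (a b c e a' b' c' e' : K) :
  b != 0 -> e != 0 ->
  ((a' * e + a * e' - (c' * b + c * b')) * (b * e)
     - (a * e - c * b) * (b' * e + b * e')) / (b * e) ^+ 2 =
  (a' * b - a * b') / b ^+ 2 - (c' * e - c * e') / e ^+ 2.
Proof. by move=> b0 e0; field; rewrite b0 e0. Qed.

Lemma quotient_ruleM (K : fieldType) (a b c e a' b' c' e' : K) :
  b != 0 -> e != 0 ->
  ((a' * c + a * c') * (b * e) - (a * c) * (b' * e + b * e')) / (b * e) ^+ 2 =
  (a' * b - a * b') / b ^+ 2 * (c / e) + a / b * ((c' * e - c * e') / e ^+ 2).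
Proof. by move=> b0 e0; field; rewrite b0 e0. Qed.

Lemma tofrac_divB (R : idomainType) (a b c e : R) : b != 0 -> e != 0 ->
  a%:F / b%:F - c%:F / e%:F = (a * e - c * b)%:F / (b * e)%:F.
Proof.
move=> b0 e0; rewrite tofracB !tofracM.
by rewrite -mulNr addf_div ?tofrac_eq0 // mulNr.
Qed.

Lemma tofrac_divM (R : idomainType) (a b c e : R) :
  a%:F / b%:F * (c%:F / e%:F) = (a * c)%:F / (b * e)%:F.
Proof. by rewrite mulf_div !tofracM. Qed.

(** The shape produced by [ratderiv_frac]. Pushing the embedding inwards reduces it to
    [quotient_ruleB], where the derivatives are free variables and [field] decides. *)
Lemma tofrac_quotient_ruleB (R : idomainType) (a b c e a' b' c' e' : R) :
  b != 0 -> e != 0 ->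
  ((a' * e + a * e' - (c' * b + c * b')) * (b * e)
     - (a * e - c * b) * (b' * e + b * e'))%:F / ((b * e) ^+ 2)%:F =
  (a' * b - a * b')%:F / (b ^+ 2)%:F - (c' * e - c * e')%:F / (e ^+ 2)%:F.
Proof.
move=> b0 e0; rewrite !(tofracXn, tofracB, tofracD, tofracM).
by rewrite quotient_ruleB ?tofrac_eq0.
Qed.

Lemma tofrac_quotient_ruleM (R : idomainType) (a b c e a' b' c' e' : R) :
  b != 0 -> e != 0 ->
  ((a' * c + a * c') * (b * e) - (a * c) * (b' * e + b * e'))%:F
    / ((b * e) ^+ 2)%:F =
  (a' * b - a * b')%:F / (b ^+ 2)%:F * (c%:F / e%:F)
    + a%:F / b%:F * ((c' * e - c * e')%:F / (e ^+ 2)%:F).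
Proof.
move=> b0 e0; rewrite !(tofracXn, tofracB, tofracD, tofracM).
by rewrite quotient_ruleM ?tofrac_eq0.
Qed.

(** The representative of a difference is not built from those of its terms; [ratderiv_frac] permits
    computing with the common denominator instead. *)
Lemma ratderiv_is_additive (R : idomainType) (n : nat) (i : 'I_n) :
  zmod_morphism (@ratderiv R n i).
Proof.
move=> f g; rewrite (frac_repr f) (frac_repr g).
have := denom_ratioP (repr f); have := denom_ratioP (repr g).
move: (\n_(repr f)) (\d_(repr f)) (\n_(repr g)) (\d_(repr g)).
move=> a b c e e0 b0.
rewrite tofrac_divB // !ratderiv_frac ?mulf_neq0 // mderivB !mderivM.
exact: tofrac_quotient_ruleB.
Qed.

HB.instance Definition _ (R : idomainType) (n : nat) (i : 'I_n) :=
  GRing.isZmodMorphism.Build _ _ (@ratderiv R n i)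
    (@ratderiv_is_additive R n i).

Lemma ratderivM (R : idomainType) (n : nat) (i : 'I_n) :
  leibniz (@ratderiv R n i).
Proof.
move=> f g; rewrite (frac_repr f) (frac_repr g).
have := denom_ratioP (repr f); have := denom_ratioP (repr g).
move: (\n_(repr f)) (\d_(repr f)) (\n_(repr g)) (\d_(repr g)).
move=> a b c e e0 b0.
rewrite tofrac_divM !ratderiv_frac ?mulf_neq0 // !mderivM.
exact: tofrac_quotient_ruleM.
Qed.

Lemma ratderivX (R : idomainType) (n : nat) (i j : 'I_n) :
  ratderiv i (('X_j : {mpoly R[n]})%:F) = (j == i)%:R.
Proof.
have -> : ('X_j : {mpoly R[n]})%:F = ('X_j)%:F / 1%:F by rewrite tofrac1 divr1.
rewrite ratderiv_frac ?oner_eq0 // expr1n tofrac1 divr1 mulr1.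
rewrite (leibniz1 (@mderivM _ _ i)) mulr0 subr0 mderivX mnm1E.
case: eqP => [->|_]; last by rewrite scale0r tofrac0.
rewrite (_ : (U_(i) - U_(i))%MM = 0%MM) ?mpolyX0 ?scale1r ?tofrac1 //.
by apply/mnmP => l; rewrite mnmBE mnm0E subnn.
Qed.

(** Partial derivatives separate the variables: d/dz_j sends z_j to 1 and every other variable to
    0. *)
Lemma tofrac_mpolyX_inj (R : idomainType) (n : nat) :
  injective (fun j : 'I_n => ('X_j : {mpoly R[n]})%:F).
Proof.
move=> i j /= h; have := ratderivX R j i; rewrite h ratderivX eqxx.
by case: eqP => // _ /eqP; rewrite oner_eq0.
Qed.

(** * The matrices [Omega] and the operators [nabla] in coordinates *)

Lemma OmegaE (R : pzRingType) (n : nat) (i j s t : 'I_n) : j != i ->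
  Omega R i j s t = ((s == j)%:R - (s == i)%:R) * ((t == i)%:R - (t == j)%:R).
Proof.
move=> ji; rewrite mxE !xpair_eqE.
have [->|si] := eqVneq s i; have [->|ti] := eqVneq t i;
  rewrite ?eqxx ?(negPf ji) 1?[i == j]eq_sym ?(negPf ji) //=.
- by rewrite sub0r subr0 mulr1.
- by case: (t == j); rewrite ?sub0r ?subr0 ?mulrNN ?mulr1 ?mulr0 ?oppr0 ?mulr0.
- by rewrite !andbT ?andbF !subr0 mulr1; case: (s == j).
- by rewrite andbF /= sub0r subr0 mulrN -natrM mulnb; case: andb; rewrite ?oppr0.
Qed.

(** [OmegaE] exhibits the rank one form (e_j - e_i) (e_i - e_j)^T, so the image of v is (v_i - v_j)
    (e_j - e_i). *)
Lemma mul_OmegaE (R : pzRingType) (n : nat) (i j s : 'I_n) (v : 'cV[R]_n) :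
  j != i ->
  (Omega R i j *m v) s 0 =
    ((s == j)%:R - (s == i)%:R) * (v i 0 - v j 0).
Proof.
move=> ji; rewrite mxE.
under eq_bigr do rewrite OmegaE // -mulrA.
rewrite -mulr_sumr; congr (_ * _).
under eq_bigr do rewrite mulrBl.
rewrite sumrB; congr (_ - _).
  rewrite (bigD1 i) //= eqxx mul1r big1 ?addr0 // => t ti.
  by rewrite (negPf ti) mul0r.
rewrite (bigD1 j) //= eqxx mul1r big1 ?addr0 // => t tj.
by rewrite (negPf tj) mul0r.
Qed.

Lemma nablaE (p q n : nat) (i s : 'I_n) (v : 'cV[ratfield p n]_n) :
  nabla q i v s 0 =
    ratderiv i (v s 0) - (q%:R)^-1 *
      (\sum_(j < n | j != i) (zvar p i - zvar p j)^-1 *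
         (((s == j)%:R - (s == i)%:R) * (v i 0 - v j 0))).
Proof.
rewrite /nabla !mxE; congr (_ - _ * _).
under eq_bigr do rewrite summxE mulr_suml.
rewrite exchange_big /=; apply: eq_bigr => j ji.
rewrite -mul_OmegaE // mxE mulr_sumr; apply: eq_bigr => t _.
by rewrite mxE mulrA.
Qed.

Lemma nabla_Pvec (p q n M m : nat) (i : 'I_n) :
    (0 < M)%N -> (q%:R)^-1 = - M%:R :> ratfield p n ->
  nabla q i (Pvec p n M m) =
    - (((Phi_quot p M i)^`())`_m)%:F *: delta_mx i 0.
Proof.
move=> M0 qM; pose F (j : 'I_n) := map_poly (@FracField.tofrac _) (Phi_quot p M j).
have FE j : Pvec p n M m j 0 = (F j)`_m by rewrite mxE coef_map.
have dF j : ratderiv i (F j)`_m = (map_poly (ratderiv i) (F j))`_m.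
  by rewrite [RHS]coef_map.
have FK j : F j * ('X - (zvar p j)%:P) =
    \prod_(l < n) ('X - (zvar p l)%:P) ^+ M.
  exact: (@map_quotK _ _ (@FracField.tofrac {mpoly 'F_p[n]}) n M
    (fun l => 'X_l) 'X_j (Phi_quot p M j) (Phi_quotK p j M0)).
have dz j : ratderiv i (zvar p j) = (j == i)%:R by exact: ratderivX.
have zI := @tofrac_mpolyX_inj 'F_p n.
apply/matrixP => s t; rewrite ord1 {t} nablaE !FE dF qM.
under eq_bigr do rewrite FE.
rewrite !mxE eqxx andbT; have [->|si] := eqVneq s i.
  (* In row [i] every j <> i contributes; these terms cancel the sum in [deriv_quot_eq], and only
     the x-derivative remains. *)
  rewrite (deriv_quot_eq (ratderivM i) M0 zI dz FK) mulr1 coefD coefN coefMn.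
  rewrite deriv_map coef_map -[RHS]addr0 -addrA; congr (_ + _).
  rewrite mulNr opprK coef_sum -[X in X + _]mulr_natl -mulrDr.
  rewrite -big_split big1 ?mulr0 //= => j ji.
  rewrite eq_sym (negPf ji) sub0r mulN1r mulrN coefZ coefB.
  exact: subrr.
rewrite (deriv_quot_neq (ratderivM i) M0 zI dz FK si).
(* In a row s <> i only the summand j = s is nonzero. *)
rewrite mulr0 (bigD1 s) //= eqxx subr0 mul1r big1 ?addr0; last first.
  by move=> j /andP[_ js]; rewrite eq_sym (negPf js) subr0 mul0r mulr0.
by rewrite coefMn coefN coefZ coefB -[X in X - _]mulr_natl mulNr mulrN addrN.
Qed.

Lemma nablaZ (p q n : nat) (i : 'I_n) (c : ratfield p n)
    (v : 'cV[ratfield p n]_n) :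
  nabla q i (c *: v) = ratderiv i c *: v + c *: nabla q i v.
Proof.
rewrite /nabla scalerBr -scalemxAr addrA; congr (_ - _); last first.
  by rewrite !scalerA mulrC.
by apply/matrixP => s t; rewrite !mxE ratderivM.
Qed.

Lemma nabla_sum (p q n : nat) (i : 'I_n) (I : finType)
    (v : I -> 'cV[ratfield p n]_n) :
  nabla q i (\sum_l v l) = \sum_l nabla q i (v l).
Proof.
rewrite /nabla sumrB -scaler_sumr -mulmx_sumr; congr (_ - _).
apply/matrixP => s t; rewrite summxE mxE summxE raddf_sum.
by apply: eq_bigr => l _; rewrite mxE.
Qed.

(** * Characteristic p and invariance of the span *)

Lemma natr_ratfield (p n : nat) : prime p -> p%:R = 0 :> ratfield p n.
Proof.
move=> p_prime; rewrite -(rmorph_nat (@FracField.tofrac _)).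
by rewrite -(rmorph_nat (@mpolyC n 'F_p)) pchar_Fp_0 // !rmorph0.
Qed.

Theorem lemma3p3 (p q k n a : nat)
    (p_prime : prime p) (q_prime : prime q) (k_gt0 : (0 < k)%N)
    (n_eq : n = (k * q + 1)%N) (n_lt_p : (n < p)%N)
    (a_ge1 : (1 <= a)%N) (a_lt_q : (a < q)%N) (q_dvd : (q %| a * p - 1)%N) :
  (forall (i : 'I_n) (v : 'cV[ratfield p n]_n),
     v \in arith_space p q k n a -> nabla q i v \in arith_space p q k n a) /\
  (forall (c : 'I_(a * k) -> ratfield p n) (i : 'I_n),
     let I := \sum_(l < a * k) c l *: arith_sol p q n l in
     let J := \sum_(l < a * k) ratderiv i (c l) *: arith_sol p q n l in
     nabla q i I = J /\ J \in arith_space p q k n a).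
Proof.
have p_gt1 := prime_gt1 p_prime.
have ap_gt1 : (1 < a * p)%N by rewrite (leq_trans p_gt1) ?leq_pmull.
have M_gt0 : (0 < (a * p - 1) %/ q)%N.
  by rewrite divn_gt0 ?prime_gt0 // dvdn_leq // subn_gt0.
have qM : (q%:R)^-1 = - ((a * p - 1) %/ q)%:R :> ratfield p n.
  (* M q = a p - 1 becomes -1 in characteristic p. This identity also shows that q is nonzero in the
     field. *)
  have qM1 : q%:R * - ((a * p - 1) %/ q)%:R = 1 :> ratfield p n.
    rewrite mulrN -natrM mulnC divnK // natrB ?(ltnW ap_gt1) // natrM.
    by rewrite natr_ratfield // mulr0 sub0r opprK.
  have q0 : q%:R != 0 :> ratfield p n.
    by apply/eqP => q0; move/eqP: qM1; rewrite q0 mul0r eq_sym oner_eq0.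
  by apply: (mulfI q0); rewrite qM1 divff.
have sol0 (i : 'I_n) (l : 'I_(a * k)) : nabla q i (arith_sol p q n l) = 0.
  (* Since l p > 0 the truncated subtraction is exact, so the coefficient of index l p - 1 of an
     x-derivative carries the factor l p. *)
  have lp : ((l.+1 * p - 1).+1 = l.+1 * p)%N.
    by rewrite subn1 prednK // muln_gt0 (prime_gt0 p_prime).
  rewrite nabla_Pvec // coef_deriv lp tofracMn mulrnA.
  by rewrite -[_ *+ p]mulr_natl natr_ratfield // mul0r oppr0 scale0r.
have nabla_comb (c : 'I_(a * k) -> ratfield p n) (i : 'I_n) :
    nabla q i (\sum_(l < a * k) c l *: arith_sol p q n l) =
    \sum_(l < a * k) ratderiv i (c l) *: arith_sol p q n l.
  rewrite nabla_sum; apply: eq_bigr => l _.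
  by rewrite nablaZ sol0 scaler0 addr0.
have mem_comb (c : 'I_(a * k) -> ratfield p n) :
    \sum_(l < a * k) c l *: arith_sol p q n l \in arith_space p q k n a.
  apply: memv_suml => l _; apply: memvZ; apply: memv_span.
  by apply: map_f; rewrite mem_enum.
split=> [i v|c i /=]; last by rewrite nabla_comb mem_comb.
(* A member of the span is a sum of vectors, one from each line; choosing a scalar on each line
   gives coefficients for [nabla_comb]. *)
rewrite {1}/arith_space span_def big_image /= => /memv_sumP[u u_line ->].
have [c cE] := fin_all_exists (fun l => vlineP _ _ (u_line l isT)).
by under eq_bigr do rewrite cE; rewrite nabla_comb mem_comb.
Qed.
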